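(* Let $(M,g)$ be an $n$-dimensional Einstein manifold with scalar curvature $s$, let $\Delta_L=\bar\Delta+\Re_2:C^\infty(S^2M)\to C^\infty(S^2M)$ be the Lichnerowicz Laplacian (with constant $c=1$), and let $\Delta_E=\bar\Delta-2\overset{\circ}{R}$ be the Einstein operator. Then $\mathrm{Ker}\,\Delta_L$ consists of eigentensors of $\Delta_E$ with eigenvalue $-2s/n$, and conversely: that is, for $\varphi\in C^\infty(S^2M)$ one has $\Delta_L\varphi=0$ if and only if $\Delta_E\varphi=-2\frac{s}{n}\varphi$. Furthermore, $\Delta_E$ is positive (resp. negative) on TT-tensors belonging to $\mathrm{Ker}\,\Delta_L$ if the scalar curvature is negative (resp. positive). In particular, if $(M,g)$ is Ricci-flat, then an arbitrary TT-tensor $\varphi$ belongs to $\mathrm{Ker}\,\Delta_L$ if and only if $\varphi$ is an infinitesimal Einstein deformation of the metric $g$.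
   Context: $S^2M$ is the bundle of symmetric covariant 2-tensors on $M$. An Einstein manifold is a Riemannian manifold of dimension $n\ge2$ with $\mathrm{Ric}=\kappa g$ for a real constant $\kappa$; then $\kappa=s/n$. $\bar\Delta=\nabla^*\nabla=-\mathrm{trace}(\nabla^2)$ is the rough Laplacian of the Levi-Civita connection. Curvature components are $R(e_j,e_l)e_k=R^i_{kjl}e_i$, $R_{ijkl}=g_{im}R^m_{jkl}$, $R_{kl}=R^i_{kil}$, with $\sec(e_i\wedge e_j)=R_{ijij}$ for orthonormal $e_i,e_j$. The curvature operator of the second kind acts on symmetric 2-tensors by $(\overset{\circ}{R}\varphi)_{ij}=R_{ikjl}\varphi^{kl}$, and $(\Re_2(\varphi))_{ij}=R_{ik}\varphi^k_j+R_{jk}\varphi^k_i-2R_{ikjl}\varphi^{kl}$. A TT-tensor is a divergence-free, traceless smooth section of $S^2M$. An infinitesimal Einstein deformation of $g$ is a TT-tensor $\varphi$ with $\Delta_E\varphi=0$. ''$\Delta_E$ is positive (resp. negative) on a set of tensors'' means that $g(\Delta_E\varphi,\varphi)>0$ (resp. $<0$) wherever $\varphi\neq0$, for each $\varphi$ in the set. *)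

(* Defs.v *)
From HB Require Import structures.
From mathcomp Require Import all_boot all_order all_algebra.
From mathcomp Require Import all_classical all_reals all_analysis.

Set Implicit Arguments.
Unset Strict Implicit.
Unset Printing Implicit Defensive.

Import Order.TTheory GRing.Theory Num.Theory.
Import numFieldNormedType.Exports.

Local Open Scope classical_set_scope.
Local Open Scope ring_scope.

(* No differential geometry is available in the library, so tensor fields are
   handled in classical index notation: a tensor field on a smooth manifold is
   a family of component functions, one for each chart of the atlas, related
   by the usual transformation law; the operators are given by their classical
   coordinate expressions, and an identity between tensor fields means equality
   of the components at every point of every chart. *)

Definition partial (R : realType) (n : nat) (i : 'I_n) (f : 'rV[R]_n -> R) :
    'rV[R]_n -> R :=
  fun u => 'D_(delta_mx 0 i) f u.

Definition iter_partial (R : realType) (n : nat) (s : seq 'I_n)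
    (f : 'rV[R]_n -> R) : 'rV[R]_n -> R :=
  foldr (fun i h => partial i h) f s.

(* C^oo on U, meant for U open: all iterated partial derivatives exist and are
   continuous.  ['D_v f u] is total, hence the explicit derivability clause. *)
Definition smooth_on (R : realType) (n : nat) (U : set 'rV[R]_n)
    (f : 'rV[R]_n -> R) : Prop :=
  forall (s : seq 'I_n) (u : 'rV[R]_n), U u ->
    {for u, continuous (iter_partial s f)} /\
    forall i : 'I_n, derivable (iter_partial s f) u (delta_mx 0 i).

(* [jac f u a i] is the partial derivative of the a-th component of f with
   respect to the i-th coordinate. *)
Definition jac (R : realType) (n : nat) (f : 'rV[R]_n -> 'rV[R]_n)
    (u : 'rV[R]_n) : 'M[R]_n :=
  \matrix_(a, i) partial i (fun v => f v 0 a) u.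

(* [cinv] is only meaningful on the open set [crange] defined below. *)
Record chart (R : realType) (n : nat) (M : topologicalType) := Chart {
  cdom : set M;
  cmap : M -> 'rV[R]_n;
  cinv : 'rV[R]_n -> M;
  cdom_open : open cdom;
  crange_open : open (cmap @` cdom);
  cmapK : forall x, cdom x -> cinv (cmap x) = x;
  cmap_continuous : {within cdom, continuous cmap};
  cinv_continuous : {within cmap @` cdom, continuous cinv} }.

Definition crange (R : realType) (n : nat) (M : topologicalType)
    (c : chart R n M) : set 'rV[R]_n := cmap c @` cdom c.

Definition overlap (R : realType) (n : nat) (M : topologicalType)
    (c d : chart R n M) : set 'rV[R]_n := cmap c @` (cdom c `&` cdom d).

Definition transition (R : realType) (n : nat) (M : topologicalType)
    (c d : chart R n M) : 'rV[R]_n -> 'rV[R]_n :=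
  fun u => cmap d (cinv c u).

Record smooth_manifold (R : realType) (n : nat) := SmoothManifold {
  carrier :> topologicalType;
  atlas : set (chart R n carrier);
  carrier_hausdorff : hausdorff_space carrier;
  carrier_second_countable : @second_countable carrier;
  atlas_cover : forall x : carrier, exists2 c, atlas c & cdom c x;
  atlas_compat : forall c d, atlas c -> atlas d ->
    forall a : 'I_n, smooth_on (overlap c d) (fun u => transition c d u 0 a) }.

(* [T c u i j] is the (i, j) component, in the chart c, at the point of
   coordinates u; only the values for c in the atlas and u in [crange c] are
   meaningful. *)
Definition components2 (R : realType) (n : nat) (M : smooth_manifold R n) :=
  chart R n M -> 'rV[R]_n -> 'M[R]_n.

Definition eq_tensor (R : realType) (n : nat) (M : smooth_manifold R n)
    (S T : components2 M) : Prop :=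
  forall c, atlas c -> forall u, crange c u -> S c u = T c u.

(* [comps_transform] is T^c_ij = (d_i y^a) (d_j y^b) T^d_ab, y = transition c d:
   with it the components define one global section of S^2 M. *)
Record sym2_field (R : realType) (n : nat) (M : smooth_manifold R n) :=
  Sym2Field {
    comps :> chart R n M -> 'rV[R]_n -> 'M[R]_n;
    comps_sym : forall c, atlas c -> forall u, crange c u ->
      (comps c u)^T = comps c u;
    comps_smooth : forall c, atlas c -> forall i j : 'I_n,
      smooth_on (crange c) (fun u => comps c u i j);
    comps_transform : forall c d, atlas c -> atlas d ->
      forall u, overlap c d u ->
        let J := jac (transition c d) u in
        comps c u = J^T *m comps d (transition c d u) *m J }.

Record riemannian_metric (R : realType) (n : nat) (M : smooth_manifold R n) :=
  RiemannianMetric {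
    metric_field :> sym2_field M;
    metric_pos : forall c, atlas c -> forall u, crange c u ->
      forall v : 'rV[R]_n, v != 0 -> 0 < (v *m metric_field c u *m v^T) 0 0 }.

(* G is the matrix (g_ij) of the metric as a function of the coordinates, and
   F the matrix (phi_ij) of a symmetric 2-tensor field. *)

Definition ginv (R : realType) (n : nat) (G : 'rV[R]_n -> 'M[R]_n)
    (u : 'rV[R]_n) : 'M[R]_n := invmx (G u).

(* Gamma^k_ij *)
Definition christoffel (R : realType) (n : nat) (G : 'rV[R]_n -> 'M[R]_n)
    (k i j : 'I_n) (u : 'rV[R]_n) : R :=
  2^-1 * \sum_(l < n) ginv G u k l *
    (partial i (fun v => G v j l) u + partial j (fun v => G v i l) u
     - partial l (fun v => G v i j) u).

(* R^i_kjl, where R(e_j, e_l) e_k = R^i_kjl e_i and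
   R(X, Y) Z = nabla_X nabla_Y Z - nabla_Y nabla_X Z - nabla_[X,Y] Z. *)
Definition riem_up (R : realType) (n : nat) (G : 'rV[R]_n -> 'M[R]_n)
    (i k j l : 'I_n) (u : 'rV[R]_n) : R :=
  partial j (christoffel G i l k) u - partial l (christoffel G i j k) u
  + \sum_(m < n) (christoffel G i j m u * christoffel G m l k u
                  - christoffel G i l m u * christoffel G m j k u).

(* R_ijkl = g_im R^m_jkl *)
Definition riem (R : realType) (n : nat) (G : 'rV[R]_n -> 'M[R]_n)
    (i j k l : 'I_n) (u : 'rV[R]_n) : R :=
  \sum_(m < n) G u i m * riem_up G m j k l u.

(* R_kl = R^i_kil *)
Definition ric (R : realType) (n : nat) (G : 'rV[R]_n -> 'M[R]_n)
    (u : 'rV[R]_n) : 'M[R]_n :=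
  \matrix_(k, l) \sum_(i < n) riem_up G i k i l u.

(* g^ij T_ij *)
Definition gtrace (R : realType) (n : nat) (G : 'rV[R]_n -> 'M[R]_n)
    (T : 'M[R]_n) (u : 'rV[R]_n) : R :=
  \sum_(i < n) \sum_(j < n) ginv G u i j * T i j.

Definition scal (R : realType) (n : nat) (G : 'rV[R]_n -> 'M[R]_n)
    (u : 'rV[R]_n) : R := gtrace G (ric G u) u.

(* phi^k_j = g^km phi_mj *)
Definition raise1 (R : realType) (n : nat) (G F : 'rV[R]_n -> 'M[R]_n)
    (k j : 'I_n) (u : 'rV[R]_n) : R :=
  \sum_(m < n) ginv G u k m * F u m j.

(* phi^kl = g^kp g^lq phi_pq *)
Definition raise2 (R : realType) (n : nat) (G F : 'rV[R]_n -> 'M[R]_n)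
    (k l : 'I_n) (u : 'rV[R]_n) : R :=
  \sum_(p < n) \sum_(q < n) ginv G u k p * ginv G u l q * F u p q.

(* g(A, B) = g^ik g^jl A_ij B_kl *)
Definition inner2 (R : realType) (n : nat) (G A B : 'rV[R]_n -> 'M[R]_n)
    (u : 'rV[R]_n) : R :=
  \sum_(k < n) \sum_(l < n) raise2 G A k l u * B u k l.

(* nabla_k phi_ij *)
Definition nabla (R : realType) (n : nat) (G F : 'rV[R]_n -> 'M[R]_n)
    (k i j : 'I_n) (u : 'rV[R]_n) : R :=
  partial k (fun v => F v i j) u
  - \sum_(m < n) (christoffel G m k i u * F u m j
                  + christoffel G m k j u * F u i m).

(* nabla_l nabla_k phi_ij = (nabla^2 phi)(e_l, e_k; e_i, e_j) *)
Definition nabla2 (R : realType) (n : nat) (G F : 'rV[R]_n -> 'M[R]_n)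
    (l k i j : 'I_n) (u : 'rV[R]_n) : R :=
  partial l (nabla G F k i j) u
  - \sum_(m < n) (christoffel G m l k u * nabla G F m i j u
                  + christoffel G m l i u * nabla G F k m j u
                  + christoffel G m l j u * nabla G F k i m u).

(* - g^lk nabla_l nabla_k phi_ij *)
Definition rough_laplacian (R : realType) (n : nat)
    (G F : 'rV[R]_n -> 'M[R]_n) (u : 'rV[R]_n) : 'M[R]_n :=
  \matrix_(i, j)
    (- \sum_(l < n) \sum_(k < n) ginv G u l k * nabla2 G F l k i j u).

(* Curvature operator of the second kind: R_ikjl phi^kl *)
Definition curv_op (R : realType) (n : nat)
    (G F : 'rV[R]_n -> 'M[R]_n) (u : 'rV[R]_n) : 'M[R]_n :=
  \matrix_(i, j)
    \sum_(k < n) \sum_(l < n) riem G i k j l u * raise2 G F k l u.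

(* R_ik phi^k_j + R_jk phi^k_i - 2 R_ikjl phi^kl *)
Definition weitzenbock2 (R : realType) (n : nat)
    (G F : 'rV[R]_n -> 'M[R]_n) (u : 'rV[R]_n) : 'M[R]_n :=
  \matrix_(i, j)
    ((\sum_(k < n) ric G u i k * raise1 G F k j u)
     + (\sum_(k < n) ric G u j k * raise1 G F k i u)
     - 2 * \sum_(k < n) \sum_(l < n) riem G i k j l u * raise2 G F k l u).

(* g^ki nabla_k phi_ij; the sign convention for the divergence is immaterial
   since only its vanishing is used. *)
Definition divergence (R : realType) (n : nat) (G F : 'rV[R]_n -> 'M[R]_n)
    (j : 'I_n) (u : 'rV[R]_n) : R :=
  \sum_(k < n) \sum_(i < n) ginv G u k i * nabla G F k i j u.

Definition einstein (R : realType) (n : nat) (M : smooth_manifold R n)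
    (g : riemannian_metric M) : Prop :=
  exists kappa : R,
    eq_tensor (fun c => ric (g c)) (fun c u => kappa *: g c u).

Definition ricci_flat (R : realType) (n : nat) (M : smooth_manifold R n)
    (g : riemannian_metric M) : Prop :=
  eq_tensor (fun c => ric (g c)) (fun _ _ => 0).

Definition has_scalar_curvature (R : realType) (n : nat)
    (M : smooth_manifold R n) (g : riemannian_metric M) (s : R) : Prop :=
  forall c, atlas c -> forall u, crange c u -> scal (g c) u = s.

Definition lichnerowicz (R : realType) (n : nat) (M : smooth_manifold R n)
    (g : riemannian_metric M) (phi : sym2_field M) : components2 M :=
  fun c u => rough_laplacian (g c) (phi c) u + weitzenbock2 (g c) (phi c) u.

Definition einstein_operator (R : realType) (n : nat) (M : smooth_manifold R n)
    (g : riemannian_metric M) (phi : sym2_field M) : components2 M :=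
  fun c u => rough_laplacian (g c) (phi c) u - 2 *: curv_op (g c) (phi c) u.

Definition ker_op (R : realType) (n : nat) (M : smooth_manifold R n)
    (D : sym2_field M -> components2 M) : set (sym2_field M) :=
  [set phi | eq_tensor (D phi) (fun _ _ => 0)].

Definition TT_tensor (R : realType) (n : nat) (M : smooth_manifold R n)
    (g : riemannian_metric M) : set (sym2_field M) :=
  [set phi : sym2_field M | forall c, atlas c -> forall u, crange c u ->
     gtrace (g c) (phi c u) u = 0 /\
     forall j : 'I_n, divergence (g c) (phi c) j u = 0].

Definition infinitesimal_einstein_deformation (R : realType) (n : nat)
    (M : smooth_manifold R n) (g : riemannian_metric M) : set (sym2_field M) :=
  TT_tensor g `&` ker_op (einstein_operator g).

Definition positive_on (R : realType) (n : nat) (M : smooth_manifold R n)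
    (g : riemannian_metric M) (D : sym2_field M -> components2 M)
    (A : set (sym2_field M)) : Prop :=
  forall phi, A phi -> forall c, atlas c -> forall u, crange c u ->
    phi c u != 0 -> 0 < inner2 (g c) (D phi c) (phi c) u.

Definition negative_on (R : realType) (n : nat) (M : smooth_manifold R n)
    (g : riemannian_metric M) (D : sym2_field M -> components2 M)
    (A : set (sym2_field M)) : Prop :=
  forall phi, A phi -> forall c, atlas c -> forall u, crange c u ->
    phi c u != 0 -> inner2 (g c) (D phi c) (phi c) u < 0.

(* Main.v *)
Require Import Defs.
From mathcomp Require Import all_boot all_order all_algebra.
From mathcomp Require Import all_classical all_reals all_analysis.

(** On an Einstein metric the two Ricci terms of the Weitzenboeck operator
    contract to [kappa phi] each, so that
    [Delta_L = Delta_E + 2 kappa = Delta_E + 2 s / n]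
    ([lichnerowicz_einstein]), where [s = kappa n] is the trace of
    [Ric = kappa g].  This identity is purely algebraic at each point: the
    rough Laplacian and the curvature operator enter both sides unchanged.  It
    gives the equality of [Ker Delta_L] with the eigenspace, and the Ricci-flat
    case, where [s = 0].

    On [Ker Delta_L] it follows that
    [g(Delta_E phi, phi) = - 2 (s / n) |phi|^2], so the sign claims reduce to
    [|phi|^2 > 0] wherever [phi != 0] ([inner2_gt0]).  For a positive definite
    Gram matrix [G] this holds because a factorisation [G = V^T V]
    ([cholesky]) provides an orthonormal frame, in which [|phi|^2] is a sum of
    squares of components. *)

Set Implicit Arguments.
Unset Strict Implicit.
Unset Printing Implicit Defensive.

Import Order.TTheory GRing.Theory Num.Theory.
Import numFieldNormedType.Exports.

Local Open Scope classical_set_scope.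
Local Open Scope ring_scope.

(** * Positive definite matrices and the norm of a 2-tensor *)

(** Symmetric elimination of the first coordinate: the Schur complement
    [S = C - a^-1 b^T b] of the corner [a] is again positive definite, because
    [x S x^T] is the value of the given form at the vector [(- a^-1 x b^T, x)],
    so a factor of [S] extends by one row to a factor of the whole matrix. *)
Lemma cholesky (R : rcfType) (n : nat) (P : 'M[R]_n) :
    P^T = P -> (forall v : 'rV[R]_n, v != 0 -> 0 < (v *m P *m v^T) 0 0) ->
  exists2 V : 'M[R]_n, V \in unitmx & P = V^T *m V.
Proof.
elim: n P => [|n IHn] P symP posP.
  by exists 1%:M; [exact: unitmx1 | rewrite [LHS]flatmx0 [RHS]flatmx0].
pose P' : 'M[R]_(1 + n) := P.
pose a := P' 0 0; pose b := ursubmx P'; pose C := drsubmx P'.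
have symb : dlsubmx P' = b^T by rewrite /b trmx_ursub (symP : P'^T = P').
have symC : C^T = C by rewrite /C trmx_drsub (symP : P'^T = P').
have defP : P' = block_mx a%:M b b^T C.
  by rewrite -[LHS]submxK symb [ulsubmx _]mx11_scalar !mxE !lshift0.
have posB (v : 'rV[R]_(1 + n)) :
    v != 0 -> 0 < (v *m block_mx a%:M b b^T C *m v^T) 0 0.
  by rewrite -defP; apply: posP.
have a_gt0 : 0 < a.
  have e0 : row_mx (1%:M : 'M[R]_1) (0 : 'rV[R]_n) != 0 :> 'rV[R]_(1 + n).
    by rewrite row_mx_eq0 negb_and oner_neq0.
  have := posB _ e0; rewrite mul_row_block tr_row_mx mul_row_col.
  by rewrite !mul0mx !addr0 !mul1mx trmx0 mulmx0 addr0 trmx1 mulmx1 mxE.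
have a_neq0 : a != 0 by rewrite gt_eqF.
pose S := C - a^-1 *: (b^T *m b).
have symS : S^T = S by rewrite linearB linearZ /= trmx_mul trmxK symC.
have posS (x : 'rV[R]_n) : x != 0 -> 0 < (x *m S *m x^T) 0 0.
  move=> x_neq0; pose t := - a^-1 *: (x *m b^T).
  have y_neq0 : row_mx t x != 0 :> 'rV[R]_(1 + n).
    by rewrite row_mx_eq0 negb_and x_neq0 orbT.
  have := posB _ y_neq0; rewrite mul_row_block tr_row_mx mul_row_col.
  have -> : t *m a%:M + x *m b^T = 0.
    by rewrite mul_mx_scalar scalerA mulrN divff // scaleN1r addNr.
  rewrite mul0mx add0r; congr (0 < (_ *m _) 0 0).
  by rewrite /t /S mulmxBr -scalemxAr mulmxA -scalemxAl scaleNr addrC.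
have [V unitV defS] := IHn S symS posS.
pose r := Num.sqrt a.
have r_neq0 : r != 0 by rewrite gt_eqF // sqrtr_gt0.
have rr : r * r = a by rewrite -expr2 sqr_sqrtr // ltW.
pose W : 'M[R]_(1 + n) := block_mx r%:M (r^-1 *: b) 0 V.
have unitW : W \in unitmx.
  by rewrite unitmxE det_ublock det_scalar1 unitrM unitfE r_neq0 -unitmxE.
suff : P' = W^T *m W by exists W.
rewrite defP /W tr_block_mx mulmx_block !trmx0 !mul0mx !mulmx0 !addr0.
rewrite tr_scalar_mx -scalar_mxM rr mul_scalar_mx scalerA divff // scale1r.
rewrite linearZ /= mul_mx_scalar scalerA divff // scale1r.
rewrite -scalemxAl -scalemxAr scalerA -invfM rr -defS.
by rewrite /S addrC subrK.
Qed.

Lemma mxtrace_mul_tr (R : realDomainType) (n : nat) (X : 'M[R]_n) :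
  \tr (X *m X^T) = \sum_i \sum_j X i j ^+ 2.
Proof.
rewrite /mxtrace; apply: eq_bigr => i _; rewrite mxE.
by apply: eq_bigr => j _; rewrite mxE expr2.
Qed.

Lemma mxtrace_mul_tr_gt0 (R : realDomainType) (n : nat) (X : 'M[R]_n) :
  X != 0 -> 0 < \tr (X *m X^T).
Proof.
have sq_ge0 i j : 0 <= X i j ^+ 2 by exact: sqr_ge0.
have row_ge0 i : 0 <= \sum_j X i j ^+ 2 by exact: sumr_ge0.
rewrite mxtrace_mul_tr lt_def sumr_ge0 // andbT.
apply: contraNneq => /eqP; rewrite psumr_eq0 // => /allP X0.
apply/eqP/matrixP => i j; rewrite mxE.
have := X0 i (mem_index_enum _); rewrite implyTb psumr_eq0 // => /allP Xi0.
by have := Xi0 j (mem_index_enum _); rewrite implyTb sqrf_eq0 => /eqP.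
Qed.

Section PointwiseTensorAlgebra.
Variables (R : realType) (n : nat) (G : 'rV[R]_n -> 'M[R]_n) (u : 'rV[R]_n).

Lemma inner2E (A B : 'rV[R]_n -> 'M[R]_n) :
  inner2 G A B u = \tr (ginv G u *m A u *m (ginv G u)^T *m (B u)^T).
Proof.
rewrite /inner2 /mxtrace; apply: eq_bigr => k _; rewrite mxE.
apply: eq_bigr => l _; rewrite [(B u)^T _ _]mxE; congr (_ * _).
rewrite /raise2 exchange_big mxE; apply: eq_bigr => q _ /=.
rewrite !mxE mulr_suml; apply: eq_bigr => p _.
by rewrite mulrAC.
Qed.

Lemma inner2Zl (A B : 'rV[R]_n -> 'M[R]_n) (a : R) :
  A u = a *: B u -> inner2 G A B u = a * inner2 G B B u.
Proof.
by move=> Au; rewrite !inner2E Au -scalemxAr -!scalemxAl mxtraceZ.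
Qed.

(** With [G = V^T V], the columns of [V^-1] form an orthonormal frame, and
    [X = V^-T F V^-1] lists the components of [F] in it; the squared norm of
    [F] is the sum of the squares of these components. *)
Lemma inner2_gt0 (F : 'rV[R]_n -> 'M[R]_n) :
    (G u)^T = G u ->
    (forall v : 'rV[R]_n, v != 0 -> 0 < (v *m G u *m v^T) 0 0) ->
  F u != 0 -> 0 < inner2 G F F u.
Proof.
move=> symG posG F_neq0; have [V unitV defG] := cholesky symG posG.
pose W := invmx V.
have defP : ginv G u = W *m W^T.
  have unitGu : G u \in unitmx by rewrite defG unitmx_mul unitmx_tr unitV.
  rewrite -[RHS](mulKmx unitGu) {2}defG !mulmxA mulmxK //.
  by rewrite -mulmxA -trmx_mul mulVmx // trmx1 mulmx1.
pose X := W^T *m F u *m W.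
have defF : F u = V^T *m X *m V.
  rewrite /X /W -!mulmxA mulVmx // mulmx1 mulmxA -trmx_mul mulVmx //.
  by rewrite trmx1 mul1mx.
have X_neq0 : X != 0.
  by apply: contraNneq F_neq0 => X0; rewrite defF X0 mulmx0 mul0mx.
rewrite inner2E defP trmx_mul trmxK.
suff -> : \tr (W *m W^T *m F u *m (W *m W^T) *m (F u)^T) = \tr (X *m X^T).
  exact: mxtrace_mul_tr_gt0.
by rewrite /X !trmx_mul trmxK -!mulmxA mxtrace_mulC !mulmxA.
Qed.

(** * The Ricci terms on an Einstein metric *)

Hypothesis unitG : G u \in unitmx.

Lemma contract_raise1 (F : 'rV[R]_n -> 'M[R]_n) (i j : 'I_n) :
  \sum_k G u i k * raise1 G F k j u = F u i j.
Proof.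
rewrite -[F u in RHS](mulKVmx unitG) mxE; apply: eq_bigr => k _.
by rewrite [in RHS]mxE.
Qed.

Variables (kappa : R).
Hypothesis ricG : ric G u = kappa *: G u.

Lemma scal_einstein : (G u)^T = G u -> scal G u = kappa * n%:R.
Proof.
move=> symG; rewrite /scal /gtrace ricG -(mxtrace1 R n) -(mulVmx unitG).
rewrite /mxtrace mulr_sumr; apply: eq_bigr => i _.
rewrite mxE mulr_sumr; apply: eq_bigr => j _.
have -> : G u j i = G u i j by rewrite -[in LHS]symG mxE.
by rewrite mxE mulrCA.
Qed.

Lemma weitzenbock2_einstein (F : 'rV[R]_n -> 'M[R]_n) :
    (F u)^T = F u ->
  weitzenbock2 G F u = (2 * kappa) *: F u - 2 *: curv_op G F u.
Proof.
move=> symF; have ric_term i j :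
    \sum_k ric G u i k * raise1 G F k j u = kappa * F u i j.
  rewrite -contract_raise1 mulr_sumr; apply: eq_bigr => k _.
  by rewrite ricG mxE mulrA.
apply/matrixP => i j; rewrite !mxE !ric_term.
have -> : F u j i = F u i j by rewrite -[in LHS]symF mxE.
by rewrite -mulrDl -[kappa + kappa]mulr2n -[kappa *+ 2]mulr_natl.
Qed.

End PointwiseTensorAlgebra.

(** * The two operators *)

Lemma metric_unitmx (R : realType) (n : nat) (M : smooth_manifold R n)
    (g : riemannian_metric M) c u :
  atlas c -> crange c u -> g c u \in unitmx.
Proof.
move=> ac cu; have [V unitV ->] := cholesky (comps_sym g ac cu)
  (@metric_pos _ _ _ g _ ac _ cu).
by rewrite unitmx_mul unitmx_tr unitV.
Qed.

(** The factor [s / n] is read off at a point from [s = kappa n]; it is only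
    there that the constants are related, since the manifold may be empty. *)
Lemma lichnerowicz_einstein (R : realType) (n : nat) (M : smooth_manifold R n)
    (g : riemannian_metric M) (s : R) :
    (0 < n)%N -> einstein g -> has_scalar_curvature g s ->
  forall (phi : sym2_field M) c u, atlas c -> crange c u ->
  lichnerowicz g phi c u
    = einstein_operator g phi c u + (2 * (s / n%:R)) *: phi c u.
Proof.
move=> n_gt0 [kappa ricg] hs phi c u ac cu.
have unitg := metric_unitmx g ac cu.
have -> : s / n%:R = kappa.
  rewrite -(hs c ac u cu) (scal_einstein unitg (ricg c ac u cu)).
    by rewrite mulfK // pnatr_eq0 -lt0n.
  exact: comps_sym.
rewrite /lichnerowicz /einstein_operator.
rewrite (weitzenbock2_einstein unitg (ricg c ac u cu)); last exact: comps_sym.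
by rewrite addrA addrAC.
Qed.

Theorem proposition4p1 (R : realType) (n : nat) (hn : (2 <= n)%N)
    (M : smooth_manifold R n) (g : riemannian_metric M)
    (hE : einstein g) (s : R) (hs : has_scalar_curvature g s) :
  [/\ forall phi : sym2_field M,
        ker_op (lichnerowicz g) phi <->
        eq_tensor (einstein_operator g phi)
                  (fun c u => (- 2 * (s / n%:R)) *: phi c u),
      s < 0 ->
        positive_on g (einstein_operator g)
          (TT_tensor g `&` ker_op (lichnerowicz g)),
      0 < s ->
        negative_on g (einstein_operator g)
          (TT_tensor g `&` ker_op (lichnerowicz g)) &
      ricci_flat g ->
        forall phi : sym2_field M, TT_tensor g phi ->
          (ker_op (lichnerowicz g) phi <->
           infinitesimal_einstein_deformation g phi)].
Proof.
have n_gt0 : (0 < n)%N by exact: ltnW.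
have LE := lichnerowicz_einstein n_gt0 hE hs.
have ker_eigen (phi : sym2_field M) : ker_op (lichnerowicz g) phi <->
    eq_tensor (einstein_operator g phi)
              (fun c u => (- 2 * (s / n%:R)) *: phi c u).
  split=> H c ac u cu; have := LE phi c u ac cu.
    rewrite (H c ac u cu) => /esym/eqP; rewrite addr_eq0 => /eqP ->.
    by rewrite mulNr scaleNr.
  by rewrite (H c ac u cu) mulNr scaleNr addNr.
have norm_gt0 (phi : sym2_field M) c u : atlas c -> crange c u ->
    phi c u != 0 -> 0 < inner2 (g c) (phi c) (phi c) u.
  by move=> ac cu; apply: inner2_gt0; [exact: comps_sym | exact: metric_pos].
have eigen_inner (phi : sym2_field M) c u : ker_op (lichnerowicz g) phi ->
    atlas c -> crange c u ->
    inner2 (g c) (einstein_operator g phi c) (phi c) u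
      = - 2 * (s / n%:R) * inner2 (g c) (phi c) (phi c) u.
  by move=> /ker_eigen H ac cu; apply: inner2Zl; exact: H.
split=> //.
- move=> s_lt0 phi [_ kphi] c ac u cu phi_neq0.
  rewrite eigen_inner // pmulr_lgt0 ?norm_gt0 // mulNr oppr_gt0.
  by rewrite pmulr_rlt0 // pmulr_llt0 // invr_gt0 ltr0n.
- move=> s_gt0 phi [_ kphi] c ac u cu phi_neq0.
  rewrite eigen_inner // pmulr_llt0 ?norm_gt0 // mulNr oppr_lt0.
  by rewrite mulr_gt0 // divr_gt0 // ltr0n.
move=> flat phi TTphi.
have s0 (c : chart R n M) u : atlas c -> crange c u -> s = 0.
  move=> ac cu; rewrite -(hs c ac u cu) /scal (flat c ac u cu) /gtrace.
  by apply: big1 => i _; apply: big1 => j _; rewrite mxE mulr0.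
have LE0 (c : chart R n M) u : atlas c -> crange c u ->
    lichnerowicz g phi c u = einstein_operator g phi c u.
  by move=> ac cu; rewrite LE // (s0 c u) // mul0r mulr0 scale0r addr0.
split=> [kphi | [_ kphi]].
  by split=> // c ac u cu; rewrite -LE0 //; exact: kphi.
by move=> c ac u cu; rewrite LE0 //; exact: kphi.
Qed.
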